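(* Let $\frac{2}{3} < \alpha < 1$ be a constant, let $p_n = n^{-\alpha}$, and let $G \sim G(n,p_n)$. Then with high probability $G$ cannot be exactly reconstructed from its $2$-neighborhoods using the overlap method; that is, with probability tending to $1$ as $n \to \infty$, the condition required by the overlap method for $2$-neighborhoods fails: there exist distinct vertices $v \neq w$ of $G$ with $\mathcal{N}_1(v) \sim \mathcal{N}_1(w)$.
   Context: All graphs are simple and undirected. $G(n,p_n)$ is the Erdős–Rényi random graph on $[n] = \{1,\dots,n\}$: each pair of distinct vertices is an edge independently with probability $p_n$. ''With high probability'' means with probability tending to $1$ as $n \to \infty$. For a vertex $v$ of $G$, $\mathcal{N}_r(v)$ is the subgraph of $G$ induced by all vertices at graph distance at most $r$ from $v$; $\sim$ between graphs denotes graph isomorphism (vertex labels other than the role of the center are disregarded when comparing neighborhoods of different vertices). The overlap method reconstructs a graph from its $r$-neighborhoods (centers labeled, other vertices unlabeled) under the condition that $\mathcal{N}_{r-1}(v) \not\sim \mathcal{N}_{r-1}(w)$ for all vertices $v \neq w$: given $\mathcal{N}_r(v)$, each neighbor $v_0$ of $v$ is uniquely labeled by examining $\mathcal{N}_{r-1}(v_0)$, which is contained in $\mathcal{N}_r(v)$. *)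

(* Defs.v *)
From HB Require Import structures.
From mathcomp Require Import all_boot all_order all_algebra.
From mathcomp Require Import all_classical all_reals all_analysis.

Set Implicit Arguments.
Unset Strict Implicit.
Unset Printing Implicit Defensive.

Import Order.TTheory GRing.Theory Num.Theory.
Import numFieldNormedType.Exports.

Local Open Scope ring_scope.

(* The pairs of distinct vertices of [n]; a simple undirected graph on [n] is
   the set of those pairs that are edges. *)
Definition vpair (n : nat) := {e : {set 'I_n} | #|e| == 2%N}.
Definition graph (n : nat) := {set vpair n}.

Definition adj n (G : graph n) : rel 'I_n :=
  fun u v => [exists e in G, val e == [set u; v]%SET].

Lemma adj_irrefl n (G : graph n) : irreflexive (adj G).
Proof.
move=> u; apply/negbTE/existsP => -[e /andP[_ /eqP eE]].
by have := valP e; rewrite eE finset.setUid cards1.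
Qed.

Lemma adj_sym n (G : graph n) : symmetric (adj G).
Proof. by move=> u v; rewrite /adj finset.setUC. Qed.

(* The vertices at graph distance at most r from v, i.e. the endpoints of the
   walks from v with at most r edges. *)
Definition gball n (G : graph n) (r : nat) (v : 'I_n) : {set 'I_n} :=
  [set w | [exists k : 'I_r.+1, exists s : k.-tuple 'I_n,
              path (adj G) v s && (last v s == w)]]%SET.

Lemma gball_center n (G : graph n) r v : v \in gball G r v.
Proof.
rewrite inE; apply/existsP; exists ord0; apply/existsP.
by exists [tuple]; rewrite /= eqxx.
Qed.

Record rooted_graph := RootedGraph {
  rg_vertex : finType;
  rg_adj : rel rg_vertex;
  rg_root : rg_vertex }.

Definition rooted_iso (H K : rooted_graph) : Prop :=
  exists f : rg_vertex H -> rg_vertex K,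
    [/\ bijective f,
        {mono f : x y / rg_adj x y} &
        f (rg_root H) = rg_root K].

(* The subgraph induced by the ball, in which only the center is
   distinguished. *)
Definition neighborhood n (G : graph n) (r : nat) (v : 'I_n) : rooted_graph :=
  @RootedGraph {x : 'I_n | x \in gball G r v}
    (relpre val (adj G)) (Sub v (gball_center G r v)).

(* The condition under which the overlap method reconstructs G from its
   r-neighborhoods (r >= 1). *)
Definition overlap_condition n (r : nat) (G : graph n) : Prop :=
  forall v w : 'I_n, v != w ->
    ~ rooted_iso (neighborhood G r.-1 v) (neighborhood G r.-1 w).

Definition gnp_mass (R : realType) n (p : R) (G : graph n) : R :=
  \prod_(e : vpair n) (if e \in G then p else 1 - p).

Definition gnp_prob (R : realType) n (p : R) (A : graph n -> Prop) : R :=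
  \sum_(G : graph n | `[< A G >]) gnp_mass p G.

Lemma gnp_probT (R : realType) n (p : R) :
  gnp_prob p (fun _ : graph n => True) = 1.
Proof.
rewrite /gnp_prob (eq_bigl (fun G => G \in {set vpair n})) => [|G]; last exact/asboolP.
rewrite -(bigA_distr _ _ (fun=> p) (fun=> 1 - p)) big1 // => e _.
by rewrite /= addrC subrK.
Qed.

Definition with_high_probability (R : realType) (p : nat -> R)
    (A : forall n, graph n -> Prop) : Prop :=
  ((fun n => gnp_prob (p n) (A n)) @ \oo --> (1 : R))%classic.

(* Main.v *)
Require Import Defs.
From HB Require Import structures.
From mathcomp Require Import all_boot all_order all_algebra.
From mathcomp Require Import all_classical all_reals all_analysis.
From mathcomp Require Import perm zify ring lra.

Set Implicit Arguments.
Unset Strict Implicit.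
Unset Printing Implicit Defensive.

Import Order.TTheory GRing.Theory Num.Theory.
Import numFieldNormedType.Exports.

Local Open Scope ring_scope.

(** Since [alpha > 2/3], the expected number of triangles through a vertex is
at most [n ^ 2 p ^ 3 = n ^ (2 - 3 alpha)], which tends to 0: almost every
1-neighborhood is a star.  A star is determined up to isomorphism by the degree
of its center, and since [p] tends to 0 most vertices have degree well below
[n], so there are more stars than available degrees.

The pigeonhole argument is deterministic ([overlap_count]): if all
1-neighborhoods are pairwise non-isomorphic, then for every [m] at most [m]
vertices are centers of stars of degree below [m], so the [n - m] or more other
vertices each lie in a triangle or have degree at least [m].  This gives
[m (n - m) <= m T + D], where [T] counts the ordered triangles and [D] is the
sum of the degrees.  As [E T <= n ^ 3 p ^ 3] and [E D <= n ^ 2 p], Markov's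
inequality with [m = n/2] bounds the probability of the overlap condition by
[3 n ^ 2 p ^ 3 + 6 p] ([gnp_prob_overlap]), and both terms vanish. *)

(** * Stars and the pigeonhole bound *)

Definition degree n (G : graph n) (v : 'I_n) : nat := (\sum_w adj G v w)%N.

Definition triangle n (G : graph n) (v a b : 'I_n) : bool :=
  [&& adj G v a, adj G v b & adj G a b].

Definition triangles n (G : graph n) (v : 'I_n) : nat :=
  (\sum_a \sum_b triangle G v a b)%N.

Lemma gball1 n (G : graph n) v :
  gball G 1 v = (v |: [set w | adj G v w])%SET.
Proof.
apply/finset.setP => w; rewrite !inE; apply/existsP/orP.
- case=> -[[|[|k]] // klt] /existsP[s /andP[ps /eqP <-]].
  + by rewrite (tuple0 s); left.
  + by move: ps; case/tupleP: s => a s; rewrite (tuple0 s) /= andbT => ?; right.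
- case=> [/eqP ->|vw].
  + by exists ord0; apply/existsP; exists [tuple]; rewrite /= eqxx.
  + by exists ord_max; apply/existsP; exists [tuple w]; rewrite /= vw eqxx.
Qed.

Lemma card_gball1 n (G : graph n) v : #|gball G 1 v| = (degree G v).+1.
Proof.
rewrite gball1 cardsU1 !inE adj_irrefl add1n; congr _.+1.
by rewrite /degree -sum1_card big_mkcond; apply: eq_bigr => w _; rewrite inE; case: adj.
Qed.

(** An edge between two vertices other than the center would close a triangle
at the center. *)
Lemma star_adj n (G : graph n) v x y : triangles G v = 0%N ->
  x \in gball G 1 v -> y \in gball G 1 v ->
  adj G x y = (x == v) (+) (y == v).
Proof.
move=> /eqP; rewrite sum_nat_eq0 => /forallP tri.
rewrite gball1 !inE.
case: (eqVneq x v) => [->|xv] /=; case: (eqVneq y v) => [->|yv] //=.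
- by rewrite adj_irrefl.
- by rewrite adj_sym.
move=> vx vy; have /= := tri x; rewrite sum_nat_eq0 => /forallP /(_ y).
by rewrite /= /triangle vx vy; case: adj.
Qed.

(** Any bijection can be corrected to respect prescribed roots by composing it
with a transposition. *)
Lemma card_eq_bij (T U : finType) (x : T) (y : U) :
  #|T| = #|U| -> exists2 f : T -> U, bijective f & f x = y.
Proof.
move=> eTU.
pose g (z : T) : U := enum_val (cast_ord eTU (enum_rank z)).
have gbij : bijective g.
  exists (fun u => enum_val (cast_ord (esym eTU) (enum_rank u))) => z;
  by rewrite /g enum_valK ?cast_ordK ?cast_ordKV enum_rankK.
exists (tperm (g x) y \o g); last by rewrite /= tpermL.
by apply: bij_comp => //; exists (tperm (g x) y); exact: tpermK.
Qed.

(** By [star_adj] adjacency in a star is expressed through equality with the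
center alone, so every root-preserving bijection is an isomorphism. *)
Lemma star_rooted_iso n (G : graph n) v w :
  triangles G v = 0%N -> triangles G w = 0%N -> degree G v = degree G w ->
  rooted_iso (neighborhood G 1 v) (neighborhood G 1 w).
Proof.
move=> tv tw dvw.
have [|f fbij froot] := @card_eq_bij _ _ (rg_root (neighborhood G 1 v))
    (rg_root (neighborhood G 1 w)).
  by rewrite !card_sig !card_gball1 dvw.
exists f; split=> // x y /=.
rewrite (star_adj tw (valP _) (valP _)) (star_adj tv (valP _) (valP _)).
have rootE z : (val (f z) == w) = (val z == v).
  have -> : (val (f z) == w) = (f z == rg_root (neighborhood G 1 w)) by [].
  by rewrite -froot (bij_eq fbij).
by rewrite !rootE.
Qed.

(** Each vertex contributes at least [m] to the right-hand side: through its
triangles, through its degree, or as one of the centers of a star of degree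
below [m].  The term [m * m] accounts for the last kind, of which there are at
most [m] because their degrees are distinct.  The form linear in the numbers of
triangles and edges is the one to which expectations apply. *)
Lemma overlap_count n (G : graph n) (m : nat) : overlap_condition 2 G ->
  (n * m <= m * m + m * (\sum_v triangles G v) + \sum_v degree G v)%N.
Proof.
move=> ov; pose S := [set v | (triangles G v == 0%N) && (degree G v < m)%N]%SET.
have Sm : (#|S| <= m)%N.
  case: m @S => [|m] S.
    by rewrite leqn0 cards_eq0; apply/eqP/finset.setP => v; rewrite !inE ltn0 andbF.
  rewrite -[leqRHS]card_ord -(@card_in_imset _ _ (fun v => inord (degree G v) : 'I_m.+1) S).
    exact: max_card.
  move=> v w; rewrite !inE => /andP[/eqP tv dv] /andP[/eqP tw dw] /(congr1 val).
  rewrite /= !inordK// => dvw; apply/eqP/negPn/negP => /ov; apply.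
  exact: star_rooted_iso.
have pointwise v : (m <= m * (v \in S) + m * triangles G v + degree G v)%N.
  by rewrite inE; case: eqVneq => ?; case: ltnP => ?; nia.
apply: (@leq_trans (\sum_v (m * (v \in S) + m * triangles G v + degree G v))%N).
  by rewrite -[in leqLHS](card_ord n) -sum_nat_const; apply: leq_sum.
rewrite !big_split /= -!big_distrr /= !leq_add2r leq_mul2l.
apply/orP; right; apply: leq_trans Sm.
by rewrite -sum1_card [leqRHS]big_mkcond; apply: leq_sum => v _; case: (v \in S).
Qed.

(** * Expectations in the random graph *)

Definition gnp_mean (R : realType) n (p : R) (X : graph n -> R) : R :=
  \sum_(G : graph n) gnp_mass p G * X G.

Section Mean.
Variables (R : realType) (n : nat) (p : R).
Hypotheses (p_ge0 : 0 <= p) (p_le1 : p <= 1).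

Lemma gnp_mass_ge0 (G : graph n) : 0 <= gnp_mass p G.
Proof. by apply: prodr_ge0 => e _; case: ifP => _ //; rewrite subr_ge0. Qed.

Lemma gnp_markov (A : graph n -> Prop) (X : graph n -> R) (c : R) :
  (forall G, 0 <= X G) -> (forall G, A G -> c <= X G) ->
  c * gnp_prob p A <= gnp_mean p X.
Proof.
move=> X0 AX; rewrite /gnp_prob big_distrr /= big_mkcond; apply: ler_sum => G _.
case: ifPn => [/asboolP AG|_]; last by rewrite mulr_ge0 ?gnp_mass_ge0.
by rewrite mulrC ler_wpM2l ?gnp_mass_ge0 // AX.
Qed.

Lemma gnp_meanD (X Y : graph n -> R) :
  gnp_mean p (fun G => X G + Y G) = gnp_mean p X + gnp_mean p Y.
Proof. by rewrite /gnp_mean -big_split; apply: eq_bigr => G _; rewrite mulrDr. Qed.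

Lemma gnp_meanZ (c : R) (X : graph n -> R) :
  gnp_mean p (fun G => c * X G) = c * gnp_mean p X.
Proof. by rewrite /gnp_mean mulr_sumr; apply: eq_bigr => G _; rewrite mulrCA. Qed.

Lemma gnp_mean_sum_le (I : finType) (X : graph n -> I -> nat) (c : R) :
  (forall i, gnp_mean p (fun G => (X G i)%:R) <= c) ->
  gnp_mean p (fun G => (\sum_i X G i)%N%:R) <= #|I|%:R * c.
Proof.
move=> Xc.
have -> : gnp_mean p (fun G => (\sum_i X G i)%N%:R) =
    \sum_i gnp_mean p (fun G => (X G i)%:R).
  rewrite /gnp_mean exchange_big /=; apply: eq_bigr => G _.
  by rewrite natr_sum mulr_sumr.
by rewrite mulr_natl -sumr_const; apply: ler_sum => i _.
Qed.

(** Expanding [\prod_e (p + q e)], with [q e = 0] on [F] and [q e = 1 - p]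
elsewhere, yields one term for each graph, and kills exactly the graphs that
miss an edge of [F]. *)
Lemma gnp_mean_subset (F : {set vpair n}) :
  gnp_mean p (fun G => (F \subset G)%:R) = p ^+ #|F|.
Proof.
rewrite -prodr_const big_mkcond /=.
transitivity (\prod_(e : vpair n) (p + (if e \in F then 0 else 1 - p))); last first.
  by apply: eq_bigr => e _; case: ifP => _; rewrite ?addr0 // addrC subrK.
rewrite bigA_distr; apply: eq_bigr => G _.
case: (boolP (F \subset G)) => [/fintype.subsetP FG|].
  rewrite mulr1; apply: eq_bigr => e _.
  by case: ifPn => // eG; rewrite ifN //; apply: contra eG; exact: FG.
case/subsetPn => e eF eG; rewrite mulr0.
by rewrite (bigD1 e) //= (negPf eG) eF mul0r.
Qed.

Lemma adjP (u v : 'I_n) : u != v -> exists2 e : vpair n,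
  val e = [set u; v]%SET & forall G : graph n, adj G u v = (e \in G).
Proof.
move=> uv; have uv2 : #|[set u; v]%SET| == 2%N by rewrite cards2 uv.
exists (Sub [set u; v]%SET uv2) => // G.
apply/existsP/idP => [[e /andP[eG /eqP ve]]|eG].
  by rewrite (_ : Sub _ _ = e) //; apply: val_inj.
by exists (Sub [set u; v]%SET uv2); rewrite eG /=.
Qed.

Lemma gnp_mean_adj (u v : 'I_n) : gnp_mean p (fun G => (adj G u v)%:R) <= p.
Proof.
have [->|/adjP[e _ eG]] := eqVneq u v.
  by rewrite /gnp_mean big1 // => G _; rewrite adj_irrefl mulr0.
rewrite (_ : (fun _ => _) = fun G : graph n => ([set e]%SET \subset G)%:R).
  by rewrite gnp_mean_subset cards1.
by apply/funext => G; rewrite eG finset.sub1set.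
Qed.

(** When two of the three vertices coincide the triangle cannot occur; otherwise
its three edges are distinct. *)
Lemma gnp_mean_triangle (v a b : 'I_n) :
  gnp_mean p (fun G => (triangle G v a b)%:R) <= p ^+ 3.
Proof.
have degenerate : [|| v == a, v == b | a == b] ->
    gnp_mean p (fun G => (triangle G v a b)%:R) <= p ^+ 3.
  move=> eq; rewrite /gnp_mean big1 ?exprn_ge0 // => G _; rewrite /triangle.
  by case/or3P: eq => /eqP ->; rewrite adj_irrefl /= ?andbF mulr0.
have [va|va] := boolP (v == a); first by apply: degenerate; rewrite va.
have [vb|vb] := boolP (v == b); first by apply: degenerate; rewrite vb orbT.
have [ab|ab] := boolP (a == b); first by apply: degenerate; rewrite ab !orbT.
have [e1 ve1 e1G] := adjP va; have [e2 ve2 e2G] := adjP vb.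
have [e3 ve3 e3G] := adjP ab.
pose F := (e1 |: (e2 |: [set e3]))%SET.
have cF : #|F| = 3%N.
  (* Two of the edges are told apart by a vertex that lies in only one. *)
  have e23 : e2 != e3.
    apply: contra va => /eqP/(congr1 val); rewrite ve2 ve3 => /finset.setP/(_ v).
    by rewrite !inE eqxx (negPf vb) !orbF => /esym.
  have e12 : e1 != e2.
    apply: contra ab => /eqP/(congr1 val); rewrite ve1 ve2 => /finset.setP/(_ a).
    by rewrite !inE eqxx orbT [a == v]eq_sym (negPf va) => /esym.
  have e13 : e1 != e3.
    apply: contra vb => /eqP/(congr1 val); rewrite ve1 ve3 => /finset.setP/(_ v).
    by rewrite !inE eqxx (negPf va) => /esym.
  by rewrite /F cardsU1 cardsU1 cards1 !inE (negPf e12) (negPf e13) (negPf e23).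
rewrite (_ : (fun _ => _) = fun G : graph n => (F \subset G)%:R).
  by rewrite gnp_mean_subset cF.
by apply/funext => G; rewrite /triangle e1G e2G e3G /F !finset.subUset !finset.sub1set.
Qed.

Lemma gnp_prob_setC (A : graph n -> Prop) :
  gnp_prob p (fun G => ~ A G) = 1 - gnp_prob p A.
Proof.
apply/eqP; rewrite eq_sym subr_eq -(gnp_probT n p) /gnp_prob.
rewrite addrC (bigID (fun G => `[< A G >])) /=; apply/eqP; congr (_ + _); apply: eq_bigl => G.
  by rewrite (asboolT I).
by rewrite (asboolT I) asbool_neg.
Qed.

Lemma gnp_prob_ge0 (A : graph n -> Prop) : 0 <= gnp_prob p A.
Proof. by apply: sumr_ge0 => G _; exact: gnp_mass_ge0. Qed.

(** Markov's inequality applied to [m T + D] with [m = n/2].  The coefficients 3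
and 6 come from [2 m <= n] and [n ^ 2 <= 6 m (n - m)]; the latter fails for
[n = 1], where [m = 0]. *)
Lemma gnp_prob_overlap : (2 <= n)%N ->
  gnp_prob p (@overlap_condition n 2) <= 3 * n%:R ^+ 2 * p ^+ 3 + 6 * p.
Proof.
move=> n2; set P := gnp_prob p _; pose m := n./2.
pose X (G : graph n) : R :=
  m%:R * (\sum_v triangles G v)%N%:R + (\sum_v degree G v)%N%:R.
have P0 : 0 <= P by exact: gnp_prob_ge0.
have PX : (n%:R * m%:R - m%:R * m%:R) * P <= gnp_mean p X.
  apply: gnp_markov => G; first by rewrite addr_ge0 ?mulr_ge0.
  move=> /(overlap_count m); rewrite -(ler_nat R) !natrD !natrM => h.
  by rewrite lerBlDl addrA.
have XE : gnp_mean p X <= m%:R * n%:R ^+ 3 * p ^+ 3 + n%:R ^+ 2 * p.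
  rewrite gnp_meanD gnp_meanZ lerD //.
    rewrite -mulrA ler_wpM2l // -[in leRHS](card_ord n) (exprS _ 2) expr2 -!mulrA.
    do 3 (apply: gnp_mean_sum_le => ?).
    exact: gnp_mean_triangle.
  rewrite -[in leRHS](card_ord n) expr2 -!mulrA.
  do 2 (apply: gnp_mean_sum_le => ?).
  exact: gnp_mean_adj.
have mn : m%:R * 2 <= n%:R :> R.
  by rewrite -natrM ler_nat /m; lia.
have nm : n%:R ^+ 2 <= 6 * (n%:R * m%:R - m%:R * m%:R) :> R.
  rewrite mulrBr lerBrDr -!natrX -!natrM -natrD ler_nat /m.
  have := odd_double_half n; move: n2; move: (n./2) (odd n) => k b.
  by case: b; nia.
have n0 : 0 < n%:R ^+ 2 :> R by rewrite exprn_gt0 // ltr0n; lia.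
rewrite -(ler_pM2l n0).
have h1 : n%:R ^+ 2 * P <= 6 * (n%:R * m%:R - m%:R * m%:R) * P by rewrite ler_wpM2r.
have h2 : m%:R * 2 * (n%:R ^+ 3 * p ^+ 3) <= n%:R * (n%:R ^+ 3 * p ^+ 3).
  by rewrite ler_wpM2r // mulr_ge0 ?exprn_ge0.
have -> : n%:R ^+ 2 * (3 * n%:R ^+ 2 * p ^+ 3 + 6 * p) =
  3 * (n%:R * (n%:R ^+ 3 * p ^+ 3)) + 6 * (n%:R ^+ 2 * p) by ring.
move: h1 h2 XE; rewrite -mulrA -[m%:R * n%:R ^+ 3 * _]mulrA [m%:R * 2 * _]mulrAC.
lra.
Qed.

End Mean.

(** * Asymptotics *)

Lemma natr_powRN_cvg0 (R : realType) (b : R) : 0 < b ->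
  (n%:R `^ (- b) @[n --> \oo] --> (0 : R))%classic.
Proof.
move=> b0; rewrite [X in (X @ _)%classic](_ : _ = (fun n : nat => (n%:R `^ b)^-1)); last first.
  by apply/funext => n; rewrite powRN.
apply/gtr0_cvgV0.
  by near=> n; rewrite powR_gt0 // ltr0n; near: n; exact: nbhs_infty_gt.
apply/cvgryPge => A.
near=> n.
apply: (@le_trans _ _ (`|A| `^ b^-1 `^ b)).
  by rewrite -powRrM mulVf ?gt_eqF // powRr1 ?ler_norm.
apply: ge0_ler_powR; rewrite ?nnegrE ?powR_ge0 ?ler0n ?(ltW b0) //.
by near: n; exact: nbhs_infty_ger.
Unshelve. all: by end_near. Qed.

Theorem proposition1 (R : realType) (alpha : R)
    (halpha1 : 2 / 3 < alpha) (halpha2 : alpha < 1) :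
  with_high_probability (fun n : nat => n%:R `^ (- alpha))
    (fun n (G : graph n) => ~ overlap_condition 2 G).
Proof.
pose bound (n : nat) : R :=
  3 * n%:R `^ (- (3 * alpha - 2)) + 6 * n%:R `^ (- alpha).
apply: (@squeeze_cvgr _ _ _ _ (fun n => 1 - bound n) (fun=> 1)).
- near=> n.
  have n2 : (2 <= n)%N by near: n; exact: nbhs_infty_ge.
  have n0 : n%:R != 0 :> R by rewrite pnatr_eq0; lia.
  set p := n%:R `^ (- alpha).
  have p0 : 0 <= p by exact: powR_ge0.
  have p1 : p <= 1.
    by rewrite -[leRHS](powRr0 n%:R) ler_powR ?ler1n; [|lia|lra].
  rewrite gnp_prob_setC lerD2l lerN2 gerBl gnp_prob_ge0 // andbT.
  apply: le_trans (gnp_prob_overlap p0 p1 n2) _.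
  rewrite -mulrA; suff -> : n%:R ^+ 2 * p ^+ 3 = n%:R `^ (- (3 * alpha - 2)) by [].
  rewrite /p -!powR_mulrn ?powR_ge0 // -powRrM -powRD ?n0 ?implybT //.
  by congr (_ `^ _); ring.
- rewrite -[X in (_ --> X)%classic]subr0; apply: cvgB; first exact: cvg_cst.
  rewrite -[X in (_ --> X)%classic](_ : 3 * 0 + 6 * 0 = 0); last by rewrite !mulr0 addr0.
  by apply: cvgD; apply: cvgMr; apply: natr_powRN_cvg0; lra.
- exact: cvg_cst.
Unshelve. all: by end_near. Qed.
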